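(* Let $\Delta \geq 4$ be an integer and let $G$ be a graph with maximum degree at most $\Delta$. If every even cycle of $G$ has length at least $6$, every odd cycle of $G$ has length at least $2\Delta - 1$ (that is, $\mathrm{evengirth}(G) \geq 6$ and $\mathrm{oddgirth}(G) \geq 2\Delta - 1$), and $\mathrm{mad}(G) < 2 + \frac{1}{3\Delta - 2}$, then $\chi_{s}'(G) \leq 2\Delta - 1$.
   Context: All graphs are simple, finite and undirected. A strong edge coloring of a graph is a proper edge coloring in which every color class is an induced matching. The strong chromatic index $\chi_{s}'(G)$ is the minimum number of colors in a strong edge coloring of $G$. The maximum average degree of $G$ is $\mathrm{mad}(G) = \max_{\emptyset \neq H \subseteq G} \frac{2|E(H)|}{|V(H)|}$, the maximum being over nonempty subgraphs $H$ of $G$. The even-girth $\mathrm{evengirth}(G)$ (resp. odd-girth $\mathrm{oddgirth}(G)$) is the length of a shortest even (resp. odd) cycle of $G$, infinite if there is none. *)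

(* Defs.v *)
From mathcomp Require Import all_boot all_order all_algebra.

Set Implicit Arguments.
Unset Strict Implicit.
Unset Printing Implicit Defensive.

Import Order.TTheory GRing.Theory Num.Theory.

Record sgraph := SGraph {
  vertex :> finType;
  adj : rel vertex;
  adj_sym : symmetric adj;
  adj_irr : irreflexive adj }.

Section Graph.

Variable G : sgraph.
Implicit Types (v : G) (s : seq G) (W : {set G}) (M : {set {set G}}).

Definition edges : {set {set G}} :=
  [set e | [exists x : G, exists y : G, adj x y && (e == [set x; y])]].

Definition degree v : nat := #|[set w | adj v w]|.

Definition max_degree : nat := \max_(v : G) degree v.

(* [s] lists the vertices of a cycle in order; its length is [size s]. The
   bound excludes the one- and two-element lists that [ucycle] accepts. *)
Definition is_cycle s : bool := (2 < size s) && ucycleb (@adj G) s.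

(* [H.1] is the vertex set and [H.2] the edge set. *)
Definition is_subgraph (H : {set G} * {set {set G}}) : bool :=
  (H.2 \subset edges) && [forall e in H.2, e \subset H.1].

(* The averages are nonnegative, so the default 0 only matters when [G] has no
   vertices, in which case [mad] is 0. *)
Definition mad : rat :=
  (\big[Num.max/0]_(H : {set G} * {set {set G}}
                    | is_subgraph H && (H.1 != set0))
     ((2 * #|H.2|)%:R / #|H.1|%:R))%R.

Definition induced_edges W : {set {set G}} := [set e in edges | e \subset W].

Definition matching M : bool := (M \subset edges) && trivIset M.

Definition induced_matching M : bool :=
  matching M && (induced_edges (cover M) == M).

Definition edge : finType := {e : {set G} | e \in edges}.

Definition proper_edge_coloring k (c : {ffun edge -> 'I_k}) : bool :=
  [forall e : edge, forall f : edge,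
     (e != f) && ~~ [disjoint val e & val f] ==> (c e != c f)].

Definition color_class k (c : {ffun edge -> 'I_k}) (i : 'I_k) :
    {set {set G}} :=
  [set val e | e : edge & c e == i].

Definition strong_edge_coloring k (c : {ffun edge -> 'I_k}) : bool :=
  proper_edge_coloring c && [forall i, induced_matching (color_class c i)].

Definition strong_edge_colorable k : bool :=
  [exists c : {ffun edge -> 'I_k}, strong_edge_coloring c].

Lemma card_edge (e : {set G}) : e \in edges -> #|e| = 2.
Proof.
rewrite inE => /existsP[x /existsP[y /andP[xy /eqP->]]].
by rewrite cards2; case: eqP xy => // ->; rewrite adj_irr.
Qed.

Lemma strong_edge_colorable_ex : exists k, strong_edge_colorable k.
Proof.
exists #|edge|; apply/existsP; exists [ffun e => enum_rank e].
apply/andP; split.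
  apply/forallP=> e; apply/forallP=> f; apply/implyP=> /andP[ef _].
  by rewrite !ffunE (inj_eq enum_rank_inj).
apply/forallP=> i.
have -> : color_class [ffun e => enum_rank e] i = [set val (enum_val i)].
  apply/setP=> A; rewrite inE; apply/imsetP/eqP => [[e]|->].
    by rewrite inE ffunE => /eqP <- ->; rewrite enum_rankK.
  by exists (enum_val i) => //; rewrite inE ffunE enum_valK.
set e := enum_val i; have eE : val e \in edges := valP e.
have cov : cover [set val e] = val e by rewrite /cover big_set1.
rewrite /induced_matching /matching /trivIset cov big_set1 eqxx sub1set eE /=.
apply/eqP/setP=> A; rewrite !inE; apply/andP/eqP => [[AE sAe]|->].
  have {}AE : A \in edges by rewrite inE.
  by apply/eqP; rewrite eqEcard sAe (card_edge AE) (card_edge eE).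
by split=> //; rewrite inE in eE.
Qed.

Definition strong_chromatic_index : nat := ex_minn strong_edge_colorable_ex.

End Graph.

(* Main.v *)
Require Import Defs.
From mathcomp Require Import all_boot all_order all_algebra.
From mathcomp Require Import zify lra.

(** Write n for Delta.  The odd graph O_n has as vertices the (n-1)-subsets of
a set of 2n-1 colours, and joins disjoint subsets.  A vertex A and a colour c
outside A determine one neighbour of A, the complement of A with c added; so
every edge AB of O_n carries the one colour missing from both A and B, and the
n edges at A carry the n colours outside A.  The other edges at A have their
colours in B and the other edges at B have theirs in A, hence this is a strong
edge coloring of O_n with 2n-1 colours.  It pulls back along every
homomorphism from G to O_n that is injective on neighbourhoods
([edge_colour_strong]), and it remains to find such a homomorphism, which is
called a labelling below.

Labellings are built by induction on the vertex set W of an induced subgraph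
([exists_labelling]).  A vertex with at most one neighbour in W can be put back
last, because in O_n every vertex has n neighbours ([extend_leaf]).  The inner
vertices of a thread, a path whose inner vertices have degree 2 in W, can be
put back as soon as O_n has a nonbacktracking walk of the length of the thread
between the labels of its ends, with first and last edges not yet used there
([extend_thread]).  Two consecutive steps in O_n exchange one colour of a set
for another, so the walks of length 2k+2 with prescribed ends and prescribed
first and last colours correspond to sequences of k exchanges between two
n-sets.  Length 2n is enough for all ends ([linked_long]).  Lengths 6, 8, up to
2n are enough when the two ends are the same vertex, and length 2n-2 when they
are adjacent ([linked_near]).

If W has minimum degree at least 2, follow a nonbacktracking walk.  If it meets
2n-1 vertices of degree 2 in a row, then these are the inner vertices of a
thread of length 2n, or the walk goes round a cycle of length at most 2n-1 all
of whose vertices have degree 2 ([first_repetition]).  By the girth hypotheses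
this cycle has even length at least 6 or length exactly 2n-1; it is a closed
thread in the first case, and in the second a thread of length 2n-2 between two
adjacent vertices ([extend_degree2_walk]).  O_n has no cycles of length 4 and
no odd cycles shorter than 2n-1, so other cycles could not be labelled.

If no such run exists, every vertex of degree 2 reaches, in each of its two
directions, a vertex of degree at least 3 within 2n-2 steps.  Each edge leaving
a vertex of degree at least 3 is reached at most 2n-2 times, so if t vertices
have degree 2 and the degrees of the others sum to d, then t <= (n-1)d
([card_degree2]), which makes the average degree at least 2 + 1/(3n-2)
([dense_of_short_runs]), against the bound on mad. *)

Set Implicit Arguments.
Unset Strict Implicit.
Unset Printing Implicit Defensive.

Import Order.TTheory GRing.Theory Num.Theory.

(** * Walks in the odd graph *)

Lemma card_gt1_neq (C : finType) (S : {set C}) a :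
  1 < #|S| -> exists2 x, x \in S & x != a.
Proof.
move=> cS; have /card_gt0P[x] : 0 < #|S :\ a|.
  by have := cardsD1 a S; case: (a \in S) => /=; lia.
by rewrite !inE => /andP[xa xS]; exists x.
Qed.

Lemma card_gt2_neq (C : finType) (S : {set C}) a b : 2 < #|S| ->
  exists x, [/\ x \in S, x != a & x != b].
Proof.
move=> cS; have : 1 < #|S :\ a|.
  by have := cardsD1 a S; case: (a \in S) => /=; lia.
case/(card_gt1_neq b) => x; rewrite !inE => /andP[xa xS] xb.
by exists x.
Qed.

Section OddGraph.

Variables (C : finType) (n : nat).
Hypothesis cardC : #|C| = 2 * n - 1.
Implicit Types (A B X Y : {set C}) (a b c d e : C).

(** The neighbour of A in the odd graph along the edge of colour c. *)
Definition across A c : {set C} := ~: (c |: A).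

Lemma card_setC_half X : #|X| = n -> #|~: X| = n - 1.
Proof. by move=> cX; have := cardsC X; rewrite cX cardC; lia. Qed.

Lemma card_across A c : 0 < n -> #|A| = n - 1 -> c \notin A ->
  #|across A c| = n - 1.
Proof.
by move=> n0 cA cNA; apply: card_setC_half; rewrite cardsU1 cNA; lia.
Qed.

Lemma disjoint_across A c : [disjoint A & across A c].
Proof. by rewrite -setI_eq0 /across setCU setICA setICr setI0. Qed.

Lemma across_inj A : {in ~: A &, injective (across A)}.
Proof.
move=> c d; rewrite !inE => cA dA E; move: (setC_inj E) => /setP/(_ c).
by rewrite !inE eqxx (negPf cA) !orbF => /esym/eqP.
Qed.

Lemma acrossP A B c : #|A| = n - 1 -> #|B| = n - 1 -> [disjoint A & B] ->
  c \notin A -> c \notin B -> B = across A c.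
Proof.
move=> cA cB AB cNA cNB; apply/eqP; rewrite eqEcard; apply/andP; split.
  apply/subsetP=> x xB; rewrite !inE negb_or (disjointFl AB xB) andbT.
  by apply: contraNneq cNB => <-.
have := cardsC (c |: A); rewrite cardsU1 cNA cA cardC cB /across; lia.
Qed.

(** The n colours outside A lead to n distinct neighbours of A, so fewer than n
forbidden sets leave one of them free. *)
Lemma fresh_colour A (F : {set {set C}}) : 0 < n ->
  #|A| = n - 1 -> #|F| < n -> exists2 a, a \notin A & across A a \notin F.
Proof.
move=> n0 cA cF; have cE : #|[set across A x | x in ~: A]| = n.
  by rewrite card_in_imset; [have := cardsC A; lia | exact: across_inj].
have /subsetPn[B /imsetP[a]] : ~~ ([set across A x | x in ~: A] \subset F).
  by apply: contraL cF => /subset_leq_card; rewrite cE -leqNgt.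
by rewrite inE => aA -> BF; exists a.
Qed.

(** A nonbacktracking walk in the odd graph from [X :\ a] to [Y :\ b], where
[X] and [Y] have n elements.  Its first edge has colour a and leads to [~: X];
its last edge has colour b and comes from [~: Y].  The complements of the sets
at odd places go from [X] to [Y] by k exchanges of one element for another, so
that such a walk amounts to a sequence of exchanges: not backtracking means
that the element just inserted is not the next one removed, the element a
counting as just inserted in [X], and that b is not the last one inserted. *)
Record odd_walk k X a Y b (w : nat -> {set C}) : Prop := OddWalk {
  walk_first : w 0 = X :\ a;
  walk_second : w 1 = ~: X;
  walk_penultimate : w k.*2.+1 = ~: Y;
  walk_last : w k.*2.+2 = Y :\ b;
  walk_card i : i <= k.*2.+2 -> #|w i| = n - 1;
  walk_disjoint i : i < k.*2.+2 -> [disjoint w i & w i.+1];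
  walk_turn i : i <= k.*2 -> w i <> w i.+2 }.

Definition linked k X a Y b : Prop := exists w, odd_walk k X a Y b w.

Lemma setD1_neq X a b : a != b -> a \in X -> X :\ a <> X :\ b.
Proof. by move=> ab aX /setP/(_ a); rewrite !inE eqxx ab aX. Qed.

Lemma card_setD1 X a : #|X| = n -> a \in X -> #|X :\ a| = n - 1.
Proof. by move=> cX aX; have := cardsD1 a X; rewrite aX cX; lia. Qed.

Lemma disjoint_setD1C X a : [disjoint X :\ a & ~: X].
Proof. by rewrite disjoints_subset setCK subD1set. Qed.

Lemma linked0 X a b : #|X| = n -> a \in X -> b \in X -> a != b ->
  linked 0 X a X b.
Proof.
move=> cX aX bX ab.
exists (fun i =>
  if i is i'.+1 then if i' is 0 then ~: X else X :\ b else X :\ a).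
split=> //=.
- case=> [|[|i]] _; rewrite ?card_setD1 //; exact: card_setC_half.
- case=> [|[|i]] // _; first exact: disjoint_setD1C.
  by rewrite disjoint_sym disjoint_setD1C.
by case=> // _; apply: setD1_neq.
Qed.

(** The exchange of d for e in [X], put before a walk that starts from the
resulting set, where e is then the element just inserted. *)
Lemma linkedS k X a d e Y b : #|X| = n -> a \in X -> d \in X -> d != a ->
  e \notin X -> linked k (e |: X :\ d) e Y b -> linked k.+1 X a Y b.
Proof.
move=> cX aX dX da eX [w [w0 w1 wp wl wc wd wt]].
have eD : (e |: X :\ d) :\ e = X :\ d.
  by rewrite setU1K // !inE negb_and eX orbT.
exists (fun i =>
  if i is i'.+1 then if i' is i''.+1 then w i'' else ~: X else X :\ a).
split=> //=.
- case=> [|[|i]] ib; [by rewrite card_setD1 | exact: card_setC_half |].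
  by apply: wc; lia.
- case=> [|[|i]] ib; first exact: disjoint_setD1C.
    by rewrite w0 eD disjoint_sym disjoint_setD1C.
  by apply: wd; lia.
case=> [|[|i]] ib.
- by rewrite w0 eD; apply: setD1_neq => //; rewrite eq_sym.
- rewrite w1 => /setC_inj /setP/(_ e).
  by rewrite !inE eqxx (negPf eX).
by apply: wt; lia.
Qed.

Lemma card_swap X d e : #|X| = n -> d \in X -> e \notin X ->
  #|e |: X :\ d| = n.
Proof.
move=> cX dX eX; rewrite cardsU1 !inE negb_and eX orbT card_setD1 //=.
have := cardsD1 d X; rewrite dX cX; lia.
Qed.

Lemma swap_setD X Y d e : e \in Y -> (e |: X :\ d) :\: Y = (X :\: Y) :\ d.
Proof.
move=> eY; apply/setP=> x; rewrite !inE.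
by case: eqP => [->|_] /=; rewrite ?eY ?andbF // andbCA.
Qed.

Lemma card_setDC X Y : #|X| = n -> #|Y| = n -> #|Y :\: X| = #|X :\: Y|.
Proof. by move=> cX cY; rewrite !cardsD cX cY setIC. Qed.

Lemma linked1 X a x Y b y : #|X| = n -> #|Y| = n -> a \in X -> b \in Y ->
  #|X :\: Y| = 1 -> x \in X :\: Y -> y \in Y :\: X -> x != a -> y != b ->
  linked 1 X a Y b.
Proof.
move=> cX cY aX bY cXY /setDP[xX xY] /setDP[yY yX] xa yb.
apply: (linkedS (d := x) (e := y)) => //.
suff -> : y |: X :\ x = Y by apply: linked0.
apply/eqP; rewrite eqEcard (card_swap cX xX yX) cY leqnn andbT.
rewrite -setD_eq0 swap_setD // -cards_eq0.
by have := cardsD1 x (X :\: Y); rewrite cXY inE xX xY; lia.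
Qed.

(** Induction on the number k of exchanges.  If [X] and [Y] differ in as many
elements as there are exchanges left, the first exchange has to bring [X]
closer to [Y]; otherwise it replaces a common element by one of [Y], which
keeps the distance.  The choices that avoid a need two candidates.  With two
exchanges left and [X] and [Y] at distance 1, a common element that is neither
a nor b has to be taken out and put back: this is where n > 3 is used. *)
Lemma linked_near k X a Y b : 3 < n -> #|X| = n -> #|Y| = n ->
  a \in X -> b \in Y -> 2 <= k < n -> 0 < #|X :\: Y| <= k -> linked k X a Y b.
Proof.
move=> n4 + cY + bY.
have pickD X' : #|X'| = n -> 0 < #|X' :\: Y| ->
    exists2 e, e \in Y & e \notin X'.
  by move=> cX'; rewrite -card_setDC // => /card_gt0P[e /setDP[]]; exists e.
elim: k X a => // k IHk X a cX aX kn mk.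
have cI : #|X :&: Y| + #|X :\: Y| = n by rewrite cardsID.
have [k2|k2] := leqP 2 k.
  have [e eY eX] := pickD X cX ltac:(lia).
  have [d [dX da dm]] : exists d, [/\ d \in X, d != a &
      0 < #|(X :\: Y) :\ d| <= k].
    have [mE|mE] := leqP #|X :\: Y| k.
      have [d] := @card_gt1_neq _ (X :&: Y) a ltac:(lia).
      rewrite inE => /andP[dX dY] da; exists d; split=> //.
      by have := cardsD1 d (X :\: Y); rewrite !inE dY; clear - mE mk; lia.
    have [d dXY da] := @card_gt1_neq _ (X :\: Y) a ltac:(lia).
    exists d; split=> //; first by case/setDP: dXY.
    by have := cardsD1 d (X :\: Y); rewrite dXY; clear - mE kn mk; lia.
  apply: (linkedS (d := d) (e := e)) => //.
  by apply: IHk; rewrite ?card_swap ?swap_setD ?setU11 //; lia.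
(* The induction starts at two exchanges, since with a single one left the
   constraints on a and b may exclude the only choice. *)
have {k2} k1 : k = 1 by lia.
move: kn mk IHk; rewrite {}k1 => _ mk _.
have [m1|m2] : #|X :\: Y| = 1 \/ #|X :\: Y| = 2 by lia.
  have [d [dXY da db]] := @card_gt2_neq _ (X :&: Y) a b ltac:(lia).
  case/setIP: dXY => dX dY.
  have [e eY eX] := pickD X cX ltac:(lia).
  have /card_gt0P[x xXY] : 0 < #|X :\: Y| by lia.
  case/setDP: (xXY) => xX xY.
  apply: (linkedS (d := d) (e := e)) => //.
  have XYd : (X :\: Y) :\ d = X :\: Y.
    by apply/eqP; rewrite eqEsubset subD1set subsetD1 subxx inE dY.
  apply: (linked1 (x := x) (y := d));
    rewrite ?card_swap ?swap_setD ?XYd ?setU11 //.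
    by rewrite !inE eqxx dY orbF andbT; apply: contraNneq eX => <-.
  by apply: contraNneq xY => ->.
have [x xXY xa] := @card_gt1_neq _ (X :\: Y) a ltac:(lia).
have cYX : 1 < #|Y :\: X| by rewrite card_setDC // m2.
have [y yYX yb] := card_gt1_neq b cYX.
have [y' yYX' yy'] := card_gt1_neq y cYX.
case/setDP: (xXY) (yYX) (yYX') => xX xY /setDP[yY yX] /setDP[yY' yX'].
apply: (linkedS (d := x) (e := y')) => //.
have c1 : #|(X :\: Y) :\ x| = 1.
  by have := cardsD1 x (X :\: Y); rewrite xXY m2 add1n => -[<-].
have /card_gt0P[z zXY] : 0 < #|(X :\: Y) :\ x| by rewrite c1.
apply: (linked1 (x := z) (y := y)); rewrite ?card_swap ?swap_setD ?setU11 //.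
  by rewrite !inE yY (negPf yX) andbF orbF andbT eq_sym.
by apply: contraTneq zXY => ->; rewrite !inE yY' andbF.
Qed.

(** Two n-sets of 2n-1 colours differ in at most n-1 elements.  If they are
equal, any first exchange takes them to distance 1, with n-2 exchanges left. *)
Lemma linked_long X a Y b : 3 < n -> #|X| = n -> #|Y| = n ->
  a \in X -> b \in Y -> linked (n - 1) X a Y b.
Proof.
move=> n4 cX cY aX bY.
have mn : #|X :\: Y| < n.
  have := max_card (X :|: Y); rewrite cardC.
  by have := cardsUI X Y; have := cardsID Y X; lia.
have [m0|m0] := posnP #|X :\: Y|; last by apply: linked_near => //; lia.
have XY : X = Y by apply/eqP; rewrite eqEcard -setD_eq0 -cards_eq0 m0 cX cY /=.
have [d dX da] := @card_gt1_neq _ X a ltac:(lia).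
have /card_gt0P[e] : 0 < #|~: X| by rewrite card_setC_half //; lia.
rewrite inE => eX; have -> : n - 1 = (n - 2).+1 by lia.
apply: (linkedS (d := d) (e := e)) => //.
apply: linked_near; rewrite ?card_swap ?setU11 //; first by lia.
have -> : (e |: X :\ d) :\: Y = [set e]; last by rewrite cards1; lia.
apply/setP=> x; rewrite !inE -XY.
case: eqP => [->|_] /=; first by rewrite eX.
by case: (x \in X); rewrite ?andbF.
Qed.

End OddGraph.

(** * Extending labellings *)

Section Labelling.

Variables (G : sgraph) (C : finType) (n : nat).
Hypothesis cardC : #|C| = 2 * n - 1.
Hypothesis n_gt3 : 3 < n.
Implicit Types (W : {set G}) (u v : G) (f : G -> {set C}).

Definition nbrs W v : {set G} := [set u in W | adj v u].

(** A homomorphism from the subgraph induced by W to the odd graph that is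
injective on neighbourhoods. *)
Record odd_labelling W f : Prop := OddLabelling {
  label_card v : v \in W -> #|f v| = n - 1;
  label_disjoint u v : u \in W -> v \in W -> adj u v -> [disjoint f u & f v];
  label_inj v : v \in W -> {in nbrs W v &, injective f} }.

Lemma label_cardU1 W f v c : odd_labelling W f -> v \in W -> c \notin f v ->
  #|c |: f v| = n.
Proof.
move=> [fc _ _] vW cN; rewrite cardsU1 cN fc // add1n subn1 prednK //.
exact: ltn_trans n_gt3.
Qed.

(** If u is the neighbour of v, then the label of u has n neighbours in the odd
graph, and at most n-1 of them are labels of neighbours of u other than v. *)
Lemma extend_leaf W v f : v \in W -> #|nbrs W v| <= 1 ->
  {in W, forall u, #|nbrs W u| <= n} -> odd_labelling (W :\ v) f ->
  exists g, odd_labelling W g.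
Proof.
move=> vW cv degW [fc fd fi].
have [B [cB dB fB]] : exists B : {set C}, [/\ #|B| = n - 1,
    forall u, u \in nbrs W v -> [disjoint f u & B] &
    forall u z, u \in nbrs W v -> z \in nbrs (W :\ v) u -> f z <> B].
  have [u uN|no] := pickP (mem (nbrs W v)); last first.
    have [B _ cB] : exists2 B : {set C}, B \subset setT & #|B| = n - 1.
      have : n - 1 <= #|[set: C]| by rewrite cardsT cardC; lia.
      case/card_geqP=> s [us ss _]; exists [set x in s]; first exact: subsetT.
      by rewrite cardsE (card_uniqP us).
    have no' u : (u \in nbrs W v) = false := no u.
    by exists B; split=> // [u|u z]; rewrite no'.
  have uE u' : u' \in nbrs W v -> u' = u.
    by move=> uN'; apply: (card_le1_eqP cv).
  have /andP[uW vu] : (u \in W) && adj v u by move: uN; rewrite !inE.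
  have uv : u != v by apply: contraTneq vu => ->; rewrite adj_irr.
  have uW' : u \in W :\ v by rewrite !inE uv.
  have vN : v \in nbrs W u by rewrite inE vW adj_sym.
  have cN : #|f @: nbrs (W :\ v) u| < n.
    apply: leq_ltn_trans (leq_imset_card _ _) _.
    have : #|nbrs (W :\ v) u| <= #|nbrs W u :\ v|.
      apply: subset_leq_card; apply/subsetP=> z.
      by rewrite !inE => /andP[/andP[-> ->] ->].
    by have := cardsD1 v (nbrs W u); rewrite vN; have := degW u uW; lia.
  have [a aA aN] := fresh_colour cardC ltac:(lia) (fc u uW') cN.
  exists (across (f u) a); split=> [|u' /uE ->|u' z /uE -> zN fz].
  - by rewrite (card_across cardC) ?fc //; exact: ltn_trans n_gt3.
  - exact: disjoint_across.
  by rewrite -fz imset_f in aN.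
exists (fun u => if u == v then B else f u); split.
- by move=> u uW; case: eqP => // /eqP uv; apply: fc; rewrite !inE uv.
- move=> u z uW zW uz; case: eqP => [uv|/eqP uv]; case: eqP => [zv|/eqP zv].
  + by move: uz; rewrite uv zv adj_irr.
  + by rewrite disjoint_sym dB // inE zW -uv.
  + by rewrite dB // inE uW -zv adj_sym.
  by apply: fd; rewrite // !inE ?uv ?zv.
move=> u uW z z'; rewrite !inE => /andP[zW uz] /andP[zW' uz'].
have uN : z = v \/ z' = v -> u \in nbrs W v.
  by case=> <-; rewrite inE uW adj_sym.
case: (z =P v) => [zv|/eqP zv]; case: (z' =P v) => [zv'|/eqP zv'].
- by rewrite zv zv'.
- move=> /esym zB; case: (fB u z' (uN (or_introl zv)) _ zB).
  by rewrite !inE zv' zW' uz'.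
- move=> zB; case: (fB u z (uN (or_intror zv')) _ zB).
  by rewrite !inE zv zW uz.
have [uv|uv] := eqVneq u v.
  by move=> _; apply: (card_le1_eqP cv); rewrite inE -uv ?zW ?zW'.
by apply: (fi u); rewrite !inE ?uv ?zv ?zv' ?zW ?zW'.
Qed.

Section Thread.

Variables (W : {set G}) (k : nat) (y : nat -> G).
Local Notation L := k.*2.+2.

Definition interior : {set G} := [set y i.+1 | i : 'I_k.*2.+1].

(** The ends may be equal or adjacent: so a cycle of vertices of degree 2 is
also covered, with one or two of its vertices as ends. *)
Record thread : Prop := Thread {
  thread_first : y 0 \in W :\: interior;
  thread_last : y L \in W :\: interior;
  thread_inW i : i < k.*2.+1 -> y i.+1 \in W;
  thread_inj i j : i < k.*2.+1 -> j < k.*2.+1 -> y i.+1 = y j.+1 -> i = j;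
  thread_nbrs i : i < k.*2.+1 -> nbrs W (y i.+1) = [set y i; y i.+2] }.

Hypothesis thr : thread.

Lemma interiorP v :
  reflect (exists2 i, i < k.*2.+1 & v = y i.+1) (v \in interior).
Proof.
apply: (iffP imsetP) => [[i _ ->]|[i iL ->]]; first by exists i.
by exists (Ordinal iL).
Qed.

Lemma interior_boundary i v : i < k.*2.+1 -> v \in W :\: interior ->
  adj (y i.+1) v -> (i = 0 /\ v = y 0) \/ (i.+2 = L /\ v = y L).
Proof.
move=> iL /setDP[vW vI] yv.
have : v \in nbrs W (y i.+1) by rewrite inE vW.
rewrite thread_nbrs // !inE => /orP[]/eqP vE.
  case: i iL yv vE => [|i] iL yv vE; first by left.
  by case/interiorP: vI; exists i => //; exact: ltnW.
have [i2L|i2L] := ltnP i.+1 k.*2.+1; first by case/interiorP: vI; exists i.+1.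
have iE : i.+2 = L by apply: anti_leq; apply/andP; split.
by right; rewrite -iE.
Qed.

Variable f : G -> {set C}.
Let W' := W :\: interior.

(** The inner vertices get the sets of the walk.  Injectivity holds at an inner
vertex because the walk does not backtrack, and at an end because the colours a
and b are not yet used there; if the ends coincide, a and b must also differ,
since then both new edges are at the same vertex. *)
Lemma extend_thread a b :
  odd_labelling W' f ->
  a \notin f (y 0) -> across (f (y 0)) a \notin f @: nbrs W' (y 0) ->
  b \notin f (y L) -> across (f (y L)) b \notin f @: nbrs W' (y L) ->
  (y 0 = y L -> a != b) ->
  linked n k (a |: f (y 0)) a (b |: f (y L)) b ->
  exists g, odd_labelling W g.
Proof.
move=> [fc fd fi] aA aN bB bN ab [w [w0 w1 wp wl wc wd wt]].
have [y0W yLW] := (thread_first thr, thread_last thr).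
rewrite setU1K // in w0; rewrite setU1K // in wl.
pose g v :=
  if [pick i : 'I_k.*2.+1 | y i.+1 == v] is Some i then w i.+1 else f v.
have gI i : i < k.*2.+1 -> g (y i.+1) = w i.+1.
  move=> iL; rewrite /g; case: pickP => [j /eqP|/(_ (Ordinal iL))/=].
    by move/(thread_inj thr (ltn_ord j) iL) => ->.
  by rewrite eqxx.
have gO v : v \in W' -> g v = f v.
  case/setDP=> _ vI; rewrite /g; case: pickP => // i /eqP yi.
  by case/interiorP: vI; exists i.
have gy i : i <= L -> g (y i) = w i.
  case: i => [|i] iL; first by rewrite gO.
  have [iL'|iL'] := ltnP i k.*2.+1; first exact: gI.
  have -> : i.+1 = L by apply: anti_leq; apply/andP; split.
  by rewrite gO.
have out v : v \in W -> v \notin interior -> v \in W'.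
  by move=> vW vI; rewrite inE vI.
exists g; split.
- move=> v vW; have [/interiorP[i iL ->]|vI] := boolP (v \in interior).
    by rewrite gI // wc // leqW.
  by rewrite gO ?fc ?out.
- have dI i v : i < k.*2.+1 -> v \in W -> adj (y i.+1) v ->
      [disjoint g (y i.+1) & g v].
    move=> iL vW yv; have : v \in nbrs W (y i.+1) by rewrite inE vW.
    rewrite thread_nbrs // !inE => /orP[]/eqP->;
      rewrite !gy ?(leqW iL) ?(leqW (ltnW iL)) //.
      by rewrite disjoint_sym wd // leqW.
    by rewrite wd.
  move=> u v uW vW uv.
  have [/interiorP[i iL uE]|uI] := boolP (u \in interior).
    by rewrite uE in uv *; apply: dI.
  have [/interiorP[i iL vE]|vI] := boolP (v \in interior).
    by rewrite vE adj_sym in uv *; rewrite disjoint_sym; apply: dI.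
  by rewrite !gO ?out //; apply: fd; rewrite ?out.
move=> v vW u u'.
have [/interiorP[i iL ->]|vI] := boolP (v \in interior).
  rewrite thread_nbrs // !inE => /orP[]/eqP-> /orP[]/eqP-> //.
    by rewrite !gy ?(leqW (ltnW iL)) // => /wt[].
  by rewrite !gy ?(leqW (ltnW iL)) // => /esym/wt[].
have {}vW := out v vW vI.
(* Outside the interior, only an end of the thread has inner neighbours. *)
have mix z z' : z \in nbrs W v -> z' \in nbrs W v -> z \in interior ->
    z' \notin interior -> g z <> g z'.
  rewrite !inE => /andP[_ vz] /andP[z'W vz'] /interiorP[i iL zE] z'I.
  have zW' := out _ z'W z'I; rewrite zE gI // (gO z') // => wE.
  have z'N : z' \in nbrs W' v by rewrite inE zW'.
  have yv : adj (y i.+1) v by rewrite adj_sym -zE.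
  case: (interior_boundary iL vW yv) => -[iE vE].
    case/negP: aN; have -> : across (f (y 0)) a = w i.+1 by rewrite iE w1.
    by rewrite -vE wE imset_f.
  case/negP: bN; have iE' : i.+1 = k.*2.+1 by apply: succn_inj.
  have -> : across (f (y L)) b = w i.+1 by rewrite iE' wp.
  by rewrite -vE wE imset_f.
move=> uN u'N.
have [uI|uI] := boolP (u \in interior);
have [u'I|u'I] := boolP (u' \in interior).
- case/interiorP: (uI) => i iL uE; case/interiorP: (u'I) => j jL u'E.
  have yv z l : z \in nbrs W v -> z = y l.+1 -> adj (y l.+1) v.
    by rewrite inE => /andP[_ vz] <-; rewrite adj_sym.
  have cross z z' : z = y 1 -> z' = y k.*2.+1 -> v = y 0 -> v = y L ->
      g z <> g z'.
    move=> -> -> v0 vL; rewrite !gy ?w1 ?wp //.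
    rewrite -v0 -vL => /(across_inj) E; have y0L : y 0 = y L by rewrite -v0.
    case/negP: (ab y0L); apply/eqP.
    by apply: E; rewrite inE; [rewrite v0 | rewrite vL].
  have pen l : l.+2 = L -> y l.+1 = y k.*2.+1 by case=> ->.
  case: (interior_boundary iL vW (yv _ _ uN uE)) => -[iE vE];
  case: (interior_boundary jL vW (yv _ _ u'N u'E)) => -[jE vE'].
  + by rewrite uE u'E iE jE.
  + by move/cross; case; rewrite // ?uE ?u'E ?iE // (pen _ jE).
  + by move/esym/cross; case; rewrite // ?uE ?u'E ?jE // (pen _ iE).
  by rewrite uE u'E; have [->] : i.+2 = j.+2 by rewrite iE.
- by move/mix; case.
- by move/esym/mix; case.
have uW : u \in W by move: uN; rewrite inE => /andP[].
have u'W : u' \in W by move: u'N; rewrite inE => /andP[].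
rewrite !gO ?out //; apply: (fi v) => //; rewrite inE out //.
  by move: uN; rewrite inE => /andP[].
by move: u'N; rewrite inE => /andP[].
Qed.

Lemma thread_first_nbr : y 1 \in nbrs W (y 0) :&: interior.
Proof.
have : y 0 \in nbrs W (y 1) by rewrite (thread_nbrs thr) // set21.
rewrite !inE adj_sym => /andP[_ ->]; rewrite (thread_inW thr) //=.
by apply/interiorP; exists 0.
Qed.

Lemma thread_last_nbr : y k.*2.+1 \in nbrs W (y L) :&: interior.
Proof.
have : y L \in nbrs W (y k.*2.+1) by rewrite (thread_nbrs thr) // set22.
rewrite !inE adj_sym => /andP[_ ->]; rewrite (thread_inW thr) //=.
by apply/interiorP; exists k.*2.
Qed.

Lemma card_nbrs_boundary v (S : {set G}) : S \subset nbrs W v :&: interior ->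
  #|nbrs W' v| + #|S| <= #|nbrs W v|.
Proof.
move=> sS; rewrite -(cardsID interior (nbrs W v)) addnC.
rewrite leq_add ?subset_leq_card //.
by apply/subsetP=> u; rewrite !inE => /andP[/andP[-> ->] ->].
Qed.

Hypothesis degW : {in W, forall v, #|nbrs W v| <= n}.

(** A neighbour inside the thread leaves room for a new edge at v. *)
Lemma card_labels_boundary v : v \in W' -> 0 < #|nbrs W v :&: interior| ->
  #|f @: nbrs W' v| < n.
Proof.
move=> /setDP[vW _] c0; apply: leq_ltn_trans (leq_imset_card _ _) _.
have := card_nbrs_boundary (subxx (nbrs W v :&: interior)).
by have := degW vW; lia.
Qed.

(** When the ends coincide, the two n-sets to be linked, got by adding distinct
colours to the same label, are at distance 1. *)
Lemma extend_closed_or_long_thread : odd_labelling W' f ->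
  k = n - 1 \/ (y 0 = y L /\ 2 <= k < n) -> exists g, odd_labelling W g.
Proof.
move=> fW kE; have [fc _ _] := fW.
have [y0W yLW] := (thread_first thr, thread_last thr).
have [a' aA aN] : exists2 a, a \notin f (y 0) &
    across (f (y 0)) a \notin f @: nbrs W' (y 0).
  apply: (fresh_colour cardC); rewrite ?fc //; first exact: ltn_trans n_gt3.
  apply: card_labels_boundary => //; apply/card_gt0P; exists (y 1).
  exact: thread_first_nbr.
have [b' [bA bN ab]] : exists b, [/\ b \notin f (y L),
    across (f (y L)) b \notin f @: nbrs W' (y L) & y 0 = y L -> a' != b].
  have [y0L|y0L] := eqVneq (y 0) (y L); last first.
    have [|||c cA cN] := fresh_colour cardC (A := f (y L))
        (F := f @: nbrs W' (y L)); rewrite ?fc //.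
    - exact: ltn_trans n_gt3.
    - apply: card_labels_boundary => //; apply/card_gt0P; exists (y k.*2.+1).
      exact: thread_last_nbr.
    by exists c; split=> // /eqP; rewrite (negPf y0L).
  (* Two neighbours of the common end are inner vertices, so there is still
     room when the edge of colour [a'] is also forbidden. *)
  have [|||c cA] := fresh_colour cardC (A := f (y L))
      (F := across (f (y L)) a' |: f @: nbrs W' (y L)); rewrite ?fc //;
      first exact: ltn_trans n_gt3.
    have y1L : y 1 != y k.*2.+1.
      apply/eqP=> yy; have := thread_inj thr (ltn0Sn _) (ltnSn _) yy.
      by move: kE; clear - n_gt3; lia.
    have sS : [set y 1; y k.*2.+1] \subset nbrs W (y L) :&: interior.
      by rewrite subUset !sub1set thread_last_nbr -y0L thread_first_nbr.
    have := card_nbrs_boundary sS; rewrite cards2 y1L /=.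
    have yLW0 : y L \in W by case/setDP: yLW.
    have := degW yLW0; have := leq_imset_card f (nbrs W' (y L)).
    rewrite cardsU1 addn2 => cI cN cN'; apply: leq_trans (leq_trans _ cN') cN.
    by rewrite ltnS -[#|nbrs _ _|.+1]add1n leq_add ?leq_b1.
  rewrite !inE negb_or => /andP[ca cN]; exists c; split=> // _.
  by apply: contraNneq ca => ->.
apply: (extend_thread fW aA aN bA bN ab).
have cX c v : c \notin f v -> v \in W' -> #|c |: f v| = n.
  by move=> cN vW; apply: (label_cardU1 fW).
case: kE => [kE|[y0L kn]].
  rewrite [X in linked _ X]kE.
  by apply: (linked_long cardC); rewrite ?cX ?setU11.
apply: (linked_near cardC); rewrite ?cX ?setU11 //.
suff -> : (a' |: f (y 0)) :\: (b' |: f (y L)) = [set a'] by rewrite cards1; lia.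
apply/setP=> x; rewrite -y0L !inE; case: (eqVneq x a') => [->|_] /=.
  by rewrite negb_or (ab y0L) aA.
by case: (x \in _); rewrite ?orbT // andbF.
Qed.

(** The labels A and B of the ends are disjoint.  The colour missing from both
is used by the edge that joins the ends, so the free colour a at A is in B and the
free colour b at B is in A.  The sets got by adding a to A and b to B therefore
share exactly a and b: they are at distance n-2, the number of exchanges
available. *)
Lemma extend_odd_cycle : odd_labelling W' f -> k = n - 2 -> adj (y 0) (y L) ->
  exists g, odd_labelling W g.
Proof.
move=> fW kE y0L; have [fc fd _] := fW.
have [y0W yLW] := (thread_first thr, thread_last thr).
have y0Ln : y 0 != y L by apply: contraTneq y0L => ->; rewrite adj_irr.
have dAB : [disjoint f (y 0) & f (y L)] by apply: fd.
have [a' aA aN] : exists2 a, a \notin f (y 0) &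
    across (f (y 0)) a \notin f @: nbrs W' (y 0).
  apply: (fresh_colour cardC); rewrite ?fc //; first exact: ltn_trans n_gt3.
  apply: card_labels_boundary => //; apply/card_gt0P; exists (y 1).
  exact: thread_first_nbr.
have [b' bB bN] : exists2 b, b \notin f (y L) &
    across (f (y L)) b \notin f @: nbrs W' (y L).
  apply: (fresh_colour cardC); rewrite ?fc //; first exact: ltn_trans n_gt3.
  apply: card_labels_boundary => //; apply/card_gt0P; exists (y k.*2.+1).
  exact: thread_last_nbr.
have aB : a' \in f (y L).
  apply: contraNT aN => aB; rewrite -(acrossP cardC _ _ dAB) ?fc //.
  by apply: imset_f; rewrite inE yLW.
have bA : b' \in f (y 0).
  apply: contraNT bN => bA; rewrite -(acrossP cardC _ _ _ bB bA) ?fc //.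
    by apply: imset_f; rewrite inE y0W adj_sym.
  by rewrite disjoint_sym.
apply: (extend_thread fW aA aN bB bN); first by move/eqP: y0Ln.
have cX c v : c \notin f v -> v \in W' -> #|c |: f v| = n.
  by move=> cN vW; apply: (label_cardU1 fW).
apply: (linked_near cardC); rewrite ?cX ?setU11 //.
  by clear - kE n_gt3; lia.
have ab : a' != b' by apply: contraNneq aA => ->.
apply/andP; split.
  have : f (y 0) :\ b' \subset (a' |: f (y 0)) :\: (b' |: f (y L)).
    apply/subsetP=> x; rewrite !inE => /andP[xb xA].
    by rewrite xA orbT andbT negb_or xb (disjointFr dAB xA).
  move/subset_leq_card; have := cardsD1 b' (f (y 0)); rewrite bA fc //.
  by clear - n_gt3; lia.
have : [set a'; b'] \subset (a' |: f (y 0)) :&: (b' |: f (y L)).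
  by rewrite subUset !sub1set !inE !eqxx aB bA !orbT.
move/subset_leq_card; rewrite cards2 ab.
have := cardsID (b' |: f (y L)) (a' |: f (y 0)); rewrite cX //.
by clear - kE; lia.
Qed.

End Thread.

End Labelling.

(** * Runs of vertices of degree 2 *)

Section Walks.

Variables (G : sgraph) (W : {set G}).
Implicit Types (u v : G) (y : nat -> G).

Record nonbacktracking y : Prop := Nonbacktracking {
  nb_in i : y i \in W;
  nb_adj i : adj (y i) (y i.+1);
  nb_turn i : y i != y i.+2 }.

Lemma nb_nbrs y i : nonbacktracking y -> #|nbrs W (y i.+1)| = 2 ->
  nbrs W (y i.+1) = [set y i; y i.+2].
Proof.
case=> yW ya yt c2; apply/esym/eqP; rewrite eqEcard c2 cards2 yt andbT.
by rewrite subUset !sub1set !inE !yW ya adj_sym ya.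
Qed.

(** The default is only reached when v has no neighbour in W other than u. *)
Definition turn u v : G := odflt v [pick w in nbrs W v | w != u].

Definition nb_walk u v i : G :=
  (iter i (fun d => (d.2, turn d.1 d.2)) (u, v)).1.

Lemma nb_walkP u v : {in W, forall x, 1 < #|nbrs W x|} ->
  u \in W -> v \in W -> adj u v -> nonbacktracking (nb_walk u v).
Proof.
move=> deg2 uW vW uv; pose y := nb_walk u v.
have yE i : y i.+2 = turn (y i) (y i.+1) by [].
have turnP u' v' : v' \in W -> turn u' v' \in nbrs W v' /\ turn u' v' != u'.
  move=> /deg2 c; rewrite /turn; case: pickP => [w /andP[] //|no].
  have [w wN wu] := card_gt1_neq u' c.
  by have := no w; rewrite wN wu.
have yP i : [/\ y i \in W, y i.+1 \in W & adj (y i) (y i.+1)].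
  elim: i => [|i [_ yW _]]; first by split.
  by have [] := turnP (y i) _ yW; rewrite -yE inE => /andP[].
split=> i; try by case: (yP i).
by case: (yP i) => _ /turnP -/(_ (y i))[_]; rewrite -yE eq_sym.
Qed.

Lemma path_walk y m l : (forall i, adj (y i) (y i.+1)) ->
  path (@adj G) (y m) [seq y i | i <- iota m.+1 l].
Proof. by move=> ya; elim: l m => //= l IHl m; rewrite ya IHl. Qed.

Variables (y : nat -> G) (m : nat).
Hypothesis nby : nonbacktracking y.
Hypothesis deg2 : forall i, i < m -> #|nbrs W (y i.+1)| = 2.

(** At the first repetition the walk is back at [y 1]: a return to a later
vertex would give it a third neighbour, or turn back on the preceding edge. *)
Lemma first_repetition :
  (forall i j, i < m.+1 -> j < m.+1 -> y i.+1 = y j.+1 -> i = j) \/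
  exists j, [/\ j <= m, 2 < j, y j.+1 = y 1 &
    forall i i', i < j -> i' < j -> y i.+1 = y i'.+1 -> i = i'].
Proof.
have [yW ya yt] := nby.
pose P j := (j <= m) && [exists i : 'I_j, y i.+1 == y j.+1].
have dist j : (forall j', j' < j -> ~~ P j') -> j <= m.+1 ->
    forall i i', i < j -> i' < j -> y i.+1 = y i'.+1 -> i = i'.
  move=> noP jm.
  have lt i i' : i < i' -> i' < j -> y i.+1 <> y i'.+1.
    move=> ii' i'j yE; case/negP: (noP _ i'j); apply/andP; split; first by lia.
    by apply/existsP; exists (Ordinal ii'); apply/eqP.
  move=> i i' ij i'j yE; case: (ltngtP i i') => // [h|h].
    by case: (lt _ _ h i'j).
  by case: (lt _ _ h ij).
have [/existsP[j0 Pj0]|noP] := boolP [exists j : 'I_m.+1, P j]; last first.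
  left; apply: dist => // j jm.
  by apply: contraNN noP => Pj; apply/existsP; exists (Ordinal jm).
right; have exP : exists j, P j by exists j0.
case: (ex_minnP exP) => j /andP[jm /existsP[i /eqP yij]] minj.
have {}dist : forall i i', i < j -> i' < j -> y i.+1 = y i'.+1 -> i = i'.
  apply: dist; last by lia.
  by move=> j' j'j; apply: contraL j'j => /minj; rewrite -leqNgt.
have i0 : i = 0 :> nat.
  case: i yij => -[//|i] /= ij yij; exfalso.
  have : y j \in nbrs W (y i.+2) by rewrite yij inE yW adj_sym ya.
  rewrite nb_nbrs //; last by apply: deg2; lia.
  case: j jm minj dist ij yij => [//|j] jm _ dist ij yij.
  rewrite !inE => /orP[]/eqP yE.
    by have := dist _ _ (ltnSn j) (ltnW ij) yE; lia.
  have [ij'|ij'] := ltnP i.+2 j.+1.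
    have ji := dist _ _ (ltnSn j) ij' yE.
    by have := yt i.+2; rewrite yij ji eqxx.
  have ii : i.+2 = j.+1 by lia.
    by have := ya i.+2; rewrite -yE ii adj_irr.
rewrite i0 in yij; exists j; split=> //.
case: j jm minj dist i i0 yij => [|[|[|j]]] //; first by move=> _ _ _ [].
  by move=> _ _ _ _ _ yij; have := ya 1; rewrite -yij adj_irr.
by move=> _ _ _ _ _ yij; have := yt 1; rewrite -yij eqxx.
Qed.

End Walks.

Section Reduction.

Variables (G : sgraph) (C : finType) (n : nat).
Hypothesis cardC : #|C| = 2 * n - 1.
Hypothesis n_gt3 : 3 < n.
Hypothesis even_girth :
  forall s : seq G, is_cycle s -> ~~ odd (size s) -> 6 <= size s.
Hypothesis odd_girth :
  forall s : seq G, is_cycle s -> odd (size s) -> 2 * n - 1 <= size s.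

Variable W : {set G}.
Hypothesis degW : {in W, forall v, #|nbrs W v| <= n}.
Hypothesis IHW : forall W' : {set G}, W' \proper W ->
  exists f : G -> {set C}, odd_labelling n W' f.

Lemma thread_proper k y : thread W k y -> W :\: interior k y \proper W.
Proof.
move=> thr; apply/properP; split; first exact: subsetDl.
exists (y 1); first exact: (thread_inW thr).
by rewrite inE negb_and negbK; apply/orP; left; apply/interiorP; exists 0.
Qed.

(** Of a cycle, one vertex is kept as the common end of a closed thread if the
length is even, and two adjacent vertices are kept if it is 2n-1. *)
Lemma extend_degree2_walk y : nonbacktracking W y ->
  (forall i, i < 2 * n - 1 -> #|nbrs W (y i.+1)| = 2) ->
  exists f : G -> {set C}, odd_labelling n W f.
Proof.
move=> nby deg2; have [yW ya yt] := nby.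
have nE i : i < 2 * n - 1 -> nbrs W (y i.+1) = [set y i; y i.+2].
  by move=> im; apply: nb_nbrs => //; apply: deg2.
have finish k z : thread W k z ->
    (k = n - 1 \/ (z 0 = z k.*2.+2 /\ 2 <= k < n)) \/
    (k = n - 2 /\ adj (z 0) (z k.*2.+2)) ->
    exists f : G -> {set C}, odd_labelling n W f.
  move=> thr cases; have [f fW] := IHW (thread_proper thr).
  case: cases => [h|[kE zz]].
    exact: (extend_closed_or_long_thread cardC n_gt3 thr degW fW).
  exact: (extend_odd_cycle cardC n_gt3 thr degW fW).
have [yinj|[j [jm j2 yj yinj]]] := first_repetition nby deg2.
  apply: (finish (n - 1) y); last by left; left.
  have -> : n - 1 = n.-1 by lia.
  split.
  (* If [y 0] were [y i.+1], its neighbour [y 1] would be [y i] or [y i.+2]. *)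
  - rewrite inE yW andbT; apply/interiorP=> -[i ib y0i].
    have : y 1 \in nbrs W (y i.+1) by rewrite -y0i inE yW ya.
    rewrite nE; last by lia.
    rewrite !inE => /orP[]/eqP; last by move/yinj; lia.
    case: i ib y0i => [|i] ib y0i.
      by move=> y10; have := ya 0; rewrite -y10 adj_irr.
    move/yinj => iE; have i0 : i = 0 by rewrite -iE //; lia.
    by have := yt 0; rewrite y0i i0 eqxx.
  - rewrite inE yW andbT; apply/interiorP=> -[i ib /yinj]; lia.
  - by [].
  - by move=> i i' ib ib' /yinj; apply; lia.
  by move=> i ib; apply: nE; lia.
have cyc : is_cycle [seq y i | i <- iota 1 j].
  rewrite /is_cycle size_map size_iota j2 /ucycleb /=; apply/andP; split.
    case: j {jm yinj} j2 yj => // j j2 yj; rewrite /= -yj -map_rcons.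
    have -> : rcons (iota 2 j) j.+2 = iota 2 j.+1.
      by rewrite -[j.+1 in RHS]addn1 iotaD cats1 add2n.
    by rewrite yj; apply: path_walk.
  rewrite map_inj_in_uniq ?iota_uniq // => -[|i] [|i']; rewrite !mem_iota; try by lia.
  by move=> ib ib' /yinj; lia.
have szc : size [seq y i | i <- iota 1 j] = j by rewrite size_map size_iota.
have := even_girth cyc; have := odd_girth cyc; rewrite szc => jodd jeven.
have thr k : k.*2.+2 <= j -> y k.*2.+3 \notin interior k (fun i => y i.+1) ->
    thread W k (fun i => y i.+1).
  move=> kj last; split=> [| |i ib|i i' ib ib'|i ib].
  - rewrite inE yW andbT; apply/interiorP=> -[i ib /yinj]; lia.
  - by rewrite inE yW andbT.
  - exact: yW.
  - by move/yinj; lia.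
  by apply: nE; lia.
case oddj : (odd j).
  have jE : j = 2 * n - 1 by have := jodd oddj; lia.
  apply: (finish (n - 2) (fun i => y i.+1)); last first.
    right; split=> //; rewrite adj_sym.
    have -> : (n - 2).*2.+3 = j by lia.
    by rewrite -yj ya.
  apply: thr; first by lia.
  by apply/interiorP=> -[i ib /yinj]; lia.
have j6 := jeven (negbT oddj).
have jE : j./2.-1.*2.+2 = j by have := odd_double_half j; rewrite oddj; lia.
apply: (finish j./2.-1 (fun i => y i.+1)).
  apply: thr; first by rewrite jE.
  rewrite jE yj; apply/interiorP=> -[i ib /yinj]; lia.
left; right; rewrite jE yj; split=> //; move: jE j6 jm; clear; lia.
Qed.

End Reduction.

(** * Short runs force many edges *)

Section Counting.

Variables (G : sgraph) (W : {set G}) (m : nat).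
Hypothesis deg_ge2 : {in W, forall v, 1 < #|nbrs W v|}.
Let T := [set v in W | #|nbrs W v| == 2].
Let S := W :\: T.
Hypothesis leave_T : forall u v, u \in W -> v \in W -> adj u v ->
  exists2 i, i < m.+1 & nb_walk W u v i.+1 \notin T.

Definition darts (A : {set G}) : {set G * G} :=
  [set d | (d.1 \in A) && (d.2 \in nbrs W d.1)].

Lemma card_darts A : #|darts A| = \sum_(v in A) #|nbrs W v|.
Proof.
rewrite -sum1_card; under [RHS]eq_bigr do rewrite -sum1_card.
by rewrite pair_big_dep; apply: eq_bigl => d; rewrite inE.
Qed.

(** A dart (v, u) at a vertex v of degree 2 is followed in the direction from u
to v; it is in [staying i] if the next i vertices also have degree 2. *)
Definition staying i : {set G * G} :=
  [set d in darts T | all (fun j => nb_walk W d.2 d.1 j.+2 \in T) (iota 0 i)].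

Lemma darts_walk d : d \in darts T -> nonbacktracking W (nb_walk W d.2 d.1).
Proof.
by rewrite !inE adj_sym => /andP[/andP[vW _] /andP[uW uv]]; apply: nb_walkP.
Qed.

Lemma nbrs_T y i : nonbacktracking W y -> y i.+1 \in T ->
  nbrs W (y i.+1) = [set y i; y i.+2].
Proof. by move=> nby; rewrite inE => /andP[_ /eqP]; apply: nb_nbrs. Qed.

(** Through vertices of degree 2 a nonbacktracking walk is determined backwards
by its last edge. *)
Lemma walk_back y z i : nonbacktracking W y -> nonbacktracking W z ->
  (forall j, j <= i -> y j.+1 \in T) ->
  y i.+1 = z i.+1 -> y i.+2 = z i.+2 -> y 0 = z 0 /\ y 1 = z 1.
Proof.
move=> nby nbz; elim: i => [|i IHi] yT y1 y2.
  split=> //; have y1T := yT 0 (leqnn 0).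
  have : y 0 \in nbrs W (z 1) by rewrite -y1 (nbrs_T nby y1T) set21.
  rewrite (nbrs_T nbz) -?y1 // !inE => /orP[/eqP//|/eqP yz].
  by have := nb_turn nby 0; rewrite y2 -yz eqxx.
apply: IHi => [j ji||//]; first by apply: yT; apply: leqW.
have y1T := yT i.+1 (leqnn _).
have : y i.+1 \in nbrs W (z i.+2) by rewrite -y1 (nbrs_T nby y1T) set21.
rewrite (nbrs_T nbz) -?y1 // !inE => /orP[/eqP//|/eqP yz].
by have := nb_turn nby i.+1; rewrite y2 -yz eqxx.
Qed.

(** By [walk_back], a dart that leaves T after i more vertices can be recovered
from the edge along which it leaves. *)
Lemma card_leaving i : #|staying i :\: staying i.+1| <= #|darts S|.
Proof.
pose h (d : G * G) := (nb_walk W d.2 d.1 i.+2, nb_walk W d.2 d.1 i.+1).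
have stayP d : d \in staying i :\: staying i.+1 -> [/\ d \in darts T,
    forall j, j <= i -> nb_walk W d.2 d.1 j.+1 \in T &
    nb_walk W d.2 d.1 i.+2 \notin T].
  have iotaS : iota 0 i.+1 = iota 0 i ++ [:: i] by rewrite -addn1 iotaD.
  rewrite in_setD ![d \in staying _]inE iotaS all_cat all_seq1.
  case: (d \in darts T) / boolP => //= dT /andP[+ allT]; rewrite allT /= => iT.
  split=> // -[|j] ji; first by move: dT; rewrite inE => /andP[].
  by move/allP: allT; apply; rewrite mem_iota.
have hinj : {in staying i :\: staying i.+1 &, injective h}.
  move=> [v u] [v' u'] /stayP[dT yT _] /stayP[dT' _ _] [y2 y1].
  have [] := walk_back (darts_walk dT) (darts_walk dT') yT y1 y2.
  by rewrite /nb_walk /= => -> ->.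
rewrite -(card_in_imset hinj); apply: subset_leq_card.
apply/subsetP=> _ /imsetP[d /stayP[dT _ lT] ->].
have [yW ya _] := darts_walk dT.
by rewrite inE /= in_setD lT yW inE yW adj_sym ya.
Qed.

(** Double counting of the pairs of a vertex of degree 2 and one of its two
directions, sorted by the number of steps after which the walk leaves T. *)
Lemma card_degree2 : 2 * #|T| <= m * \sum_(v in S) #|nbrs W v|.
Proof.
have -> : 2 * #|T| = #|darts T|.
  rewrite card_darts mulnC -sum_nat_const; apply: eq_bigr => v.
  by rewrite inE => /andP[_ /eqP].
rewrite -card_darts.
have -> : darts T = staying 0 by apply/setP=> d; rewrite !inE andbT.
have stay0 : staying m = set0.
  apply/setP=> d; rewrite in_set0; apply/negbTE/negP.
  rewrite inE => /andP[dT /allP allT].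
  move: (dT); rewrite inE => /andP[vT]; rewrite !inE => /andP[uW vu].
  have vW : d.1 \in W by move: vT; rewrite inE => /andP[].
  rewrite adj_sym in vu; have [[|i] im] := leave_T uW vW vu; first by rewrite vT.
  by rewrite allT // mem_iota.
suff H i : #|staying 0| <= i * #|darts S| + #|staying i|.
  by have := H m; rewrite stay0 cards0 addn0.
elim: i => // i IHi; apply: leq_trans IHi _.
rewrite mulSn -addnA addnCA leq_add2l -(cardsID (staying i.+1)) addnC.
by apply: leq_add (card_leaving i) (subset_leq_card (subsetIr _ _)).
Qed.

End Counting.

(** With t vertices of degree 2 and s others, whose degrees sum to d, one has
t <= (n-1)d and 3s <= d, and the claim (6n-3)(t+s) <= (3n-2)(2t+d) amounts to
t + (6n-3)s <= (3n-2)d. *)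
Lemma dense_of_short_runs (G : sgraph) (W : {set G}) n : 0 < n ->
  {in W, forall v, 1 < #|nbrs W v|} ->
  (forall u v, u \in W -> v \in W -> adj u v ->
    exists2 i, i < 2 * n - 1 & #|nbrs W (nb_walk W u v i.+1)| != 2) ->
  (6 * n - 3) * #|W| <= (3 * n - 2) * \sum_(v in W) #|nbrs W v|.
Proof.
move=> n0 deg2 leave; set T := [set v in W | #|nbrs W v| == 2].
have cT : 2 * #|T| <= (2 * n - 2) * \sum_(v in W :\: T) #|nbrs W v|.
  apply: card_degree2 => // u v uW vW uv.
  have [i im yi] := leave u v uW vW uv; exists i; first by lia.
  by rewrite inE (negPf yi) andbF.
have sT : T \subset W by apply/subsetP=> v; rewrite inE => /andP[].
have cS : 3 * #|W :\: T| <= \sum_(v in W :\: T) #|nbrs W v|.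
  rewrite mulnC -sum_nat_const; apply: leq_sum => v.
  rewrite !inE negb_and => /andP[+ vW]; rewrite vW /= => vT.
  by rewrite ltn_neqAle eq_sym vT deg2.
have sumT : \sum_(v in T) #|nbrs W v| = #|T| * 2.
  by rewrite -sum_nat_const; apply: eq_bigr => v; rewrite inE => /andP[_ /eqP].
rewrite -(cardsID T W) (setIidPr sT) (big_setID T) (setIidPr sT) /= sumT.
move: cT cS; move: #|T| #|W :\: T| (\sum_(v in _) _) => t s d; nia.
Qed.

(** * Sparse graphs have labellings *)

Section Existence.

Variables (G : sgraph) (C : finType) (n : nat).
Hypothesis cardC : #|C| = 2 * n - 1.
Hypothesis n_gt3 : 3 < n.
Hypothesis even_girth :
  forall s : seq G, is_cycle s -> ~~ odd (size s) -> 6 <= size s.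
Hypothesis odd_girth :
  forall s : seq G, is_cycle s -> odd (size s) -> 2 * n - 1 <= size s.
Hypothesis deg_le : max_degree G <= n.
Hypothesis sparse : forall W : {set G}, W != set0 ->
  (3 * n - 2) * \sum_(v in W) #|nbrs W v| < (6 * n - 3) * #|W|.

Lemma exists_labelling (W : {set G}) :
  exists f : G -> {set C}, odd_labelling n W f.
Proof.
have degW (W' : {set G}) : {in W', forall v, #|nbrs W' v| <= n}.
  move=> v _; apply: leq_trans (leq_trans (leq_bigmax v) deg_le).
  by apply: subset_leq_card; apply/subsetP=> u; rewrite !inE => /andP[].
have [l] := ubnP #|W|; elim: l W => // l IHl W; rewrite ltnS => cW.
have IHW (W' : {set G}) : W' \proper W ->
    exists f : G -> {set C}, odd_labelling n W' f.
  by move=> pW; apply: IHl; apply: leq_trans (proper_card pW) cW.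
have [->|W0] := eqVneq W set0.
  by exists (fun=> set0); split=> [v|u v|v]; rewrite inE.
have [/exists_inP[v vW v1]|/exists_inPn deg2] :=
    boolP [exists v in W, #|nbrs W v| <= 1].
  have [f fW] := IHW _ (properD1 vW).
  exact: (extend_leaf cardC n_gt3 vW v1 (@degW W) fW).
have {}deg2 : {in W, forall v, 1 < #|nbrs W v|}.
  by move=> v /deg2; rewrite -ltnNge.
have [/exists_inP[u uW /exists_inP[v vW /andP[uv /forallP run]]]|] := boolP
    [exists u in W, exists v in W, adj u v &&
      [forall i : 'I_(2 * n - 1), #|nbrs W (nb_walk W u v i.+1)| == 2]].
  apply: (extend_degree2_walk cardC n_gt3 even_girth odd_girth (@degW W) IHW
    (nb_walkP deg2 uW vW uv)) => i im.
  by apply/eqP; exact: (run (Ordinal im)).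
move=> /exists_inPn noRun; have := sparse W0; rewrite ltnNge dense_of_short_runs //.
  exact: ltn_trans n_gt3.
move=> u v uW vW uv; have /exists_inPn/(_ v vW) := noRun u uW.
by rewrite uv /= => /forallPn[i yi]; exists i.
Qed.

End Existence.

Lemma handshake (G : sgraph) (W : {set G}) :
  \sum_(v in W) #|nbrs W v| = 2 * #|induced_edges W|.
Proof.
have -> : 2 * #|induced_edges W| =
    \sum_(e in induced_edges W) \sum_(v in W | v \in e) 1.
  rewrite mulnC -sum_nat_const; apply: eq_bigr => e; rewrite inE => /andP[eE eW].
  rewrite sum1_card -(card_edge eE); apply: eq_card => v.
  by apply/idP/andP => [ve|[]//]; split=> //; apply: (subsetP eW).
rewrite (exchange_big_dep (mem W)) /=; last by move=> e v _ /andP[].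
apply: eq_bigr => v vW; rewrite sum1_card.
have inj : {in nbrs W v &, injective (fun u => [set v; u])}.
  move=> u u'; rewrite !inE => /andP[_ vu] _ /setP/(_ u); rewrite !inE eqxx orbT.
  by case/esym/orP=> /eqP // uv; rewrite uv adj_irr in vu.
rewrite -(card_in_imset inj); apply: eq_card => e; apply/imsetP/idP.
  case=> u; rewrite inE => /andP[uW vu] ->; apply/andP; split; last by rewrite vW set21.
  rewrite !inE subUset !sub1set vW uW !andbT.
  by apply/existsP; exists v; apply/existsP; exists u; rewrite vu eqxx.
case/and3P; rewrite !inE => /andP[/existsP[x /existsP[z /andP[xz /eqP->]]]].
rewrite subUset !sub1set => /andP[xW zW] _; rewrite !inE => /orP[]/eqP ->.
  by exists z; rewrite // inE zW.
by exists x; rewrite ?inE ?xW 1?adj_sym // setUC.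
Qed.

Lemma mad_ge (G : sgraph) (W : {set G}) : W != set0 ->
  ((2 * #|induced_edges W|)%:R / #|W|%:R <= mad G)%R.
Proof.
move=> W0; rewrite /mad.
apply: (le_bigmax_cond _ (j := (W, induced_edges W))
  (fun H : {set G} * {set {set G}} => ((2 * #|H.2|)%:R / #|H.1|%:R)%R)).
rewrite W0 andbT; apply/andP; split.
  by apply/subsetP=> e; rewrite inE => /andP[].
by apply/forall_inP=> e; rewrite inE => /andP[].
Qed.

Lemma sparse_of_mad (G : sgraph) n (W : {set G}) : 0 < n ->
  (mad G < 2 + 1 / (3 * n%:R - 2))%R -> W != set0 ->
  (3 * n - 2) * \sum_(v in W) #|nbrs W v| < (6 * n - 3) * #|W|.
Proof.
move=> n0 madG W0; rewrite handshake.
have w0 : (0 < #|W|%:R :> rat)%R by rewrite ltr0n card_gt0.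
have := le_lt_trans (mad_ge W0) madG; rewrite ltr_pdivrMr //.
have d0 : (0 < 3 * n%:R - 2 :> rat)%R.
  by rewrite -natrM subr_gt0 ltr_nat; lia.
rewrite -(ltr_pM2l d0) mulrA mulrDr mul1r divff ?gt_eqF // => H.
rewrite -(ltr_nat rat) !natrM !natrB; try lia.
rewrite !natrM in H *.
by apply: le_lt_trans (lt_le_trans H _); lra.
Qed.

(** * From labellings to strong edge colorings *)

Section Colouring.

Variables (G : sgraph) (n : nat) (f : G -> {set 'I_(2 * n - 1)}).
Hypothesis n_gt0 : 0 < n.
Hypothesis fP : odd_labelling n setT f.

(* The default is never taken: the labels at the ends of an edge have 2n-2
   colours together. *)
Let c0 : 'I_(2 * n - 1).
Proof. by apply: (@Ordinal _ 0); lia. Qed.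

Definition edge_colour (e : edge G) : 'I_(2 * n - 1) :=
  odflt c0 [pick c | c \notin \bigcup_(x in val e) f x].

Lemma edge_ends (e : edge G) x : x \in val e ->
  exists2 y, adj x y & val e = [set x; y].
Proof.
have := valP e; rewrite inE => /existsP[u /existsP[v /andP[uv /eqP ->]]].
rewrite !inE => /orP[]/eqP->; first by exists v.
by exists u; rewrite 1?adj_sym // setUC.
Qed.

Lemma edge_colour_notin (e : edge G) x :
  x \in val e -> edge_colour e \notin f x.
Proof.
move=> xe; have [y xy eE] := edge_ends xe.
rewrite /edge_colour; case: pickP => [c|no] /=.
  by apply: contraNN => cx; apply/bigcupP; exists x.
have allc c : c \in f x :|: f y.
  have /negbFE/bigcupP[z] := no c.
  by rewrite eE !inE => /orP[]/eqP-> ->; rewrite ?orbT.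
have [fc _ _] := fP; exfalso.
have : #|f x :|: f y| = 2 * n - 1.
  by rewrite -[RHS]card_ord; apply: eq_card => c; rewrite allc.
have [+ _] := leq_card_setU (f x) (f y); rewrite !fc ?inE //.
by clear - n_gt0; lia.
Qed.

(** If two edges of the same colour meet or are joined by the edge xy, then the
other end of the first edge and y are both labelled by the neighbour of [f x]
along that colour; as they are neighbours of x, they coincide. *)
Lemma edge_colour_near (e g : edge G) x y :
  x \in val e -> y \in val g -> adj x y -> edge_colour e = edge_colour g ->
  val e = [set x; y].
Proof.
move=> xe yg xy eg; have [fc fd fi] := fP; have [x' xx' eE] := edge_ends xe.
have cx := edge_colour_notin xe.
have cx' : edge_colour e \notin f x' by apply: edge_colour_notin; rewrite eE set22.
have cy : edge_colour e \notin f y by rewrite eg; apply: edge_colour_notin.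
have opp z : adj x z -> edge_colour e \notin f z ->
    f z = across (f x) (edge_colour e).
  move=> xz cz; apply: (acrossP (card_ord _)) => //; rewrite ?fc ?inE //.
  by apply: fd; rewrite ?inE.
suff -> : y = x' by [].
by apply: (fi x); rewrite ?inE //= (opp y) // (opp x').
Qed.

Lemma edge_colour_meet (e g : edge G) :
  ~~ [disjoint val e & val g] -> edge_colour e = edge_colour g -> e = g.
Proof.
move=> /pred0Pn[x /andP[/= xe xg]] eg; have [y xy gE] := edge_ends xg.
by apply: val_inj; rewrite gE; apply: edge_colour_near eg; rewrite // gE set22.
Qed.

Lemma edge_colour_strong : strong_edge_coloring (finfun edge_colour).
Proof.
apply/andP; split.
  apply/forallP=> e; apply/forallP=> g; apply/implyP=> /andP[eg meet].
  by rewrite !ffunE; apply: contraNneq eg => /(edge_colour_meet meet) ->.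
apply/forallP=> i; set M := color_class _ i.
have MP A : reflect (exists2 e : edge G, edge_colour e = i & A = val e) (A \in M).
  apply: (iffP imsetP) => [[e]|[e ei ->]].
    by rewrite inE ffunE => /eqP ei ->; exists e.
  by exists e; rewrite // inE ffunE ei.
have sM : M \subset edges G by apply/subsetP=> A /MP[e _ ->]; exact: valP.
apply/andP; split.
  rewrite /matching sM; apply/trivIsetP=> A B /MP[e ei ->] /MP[g gi ->].
  by apply: contraNT => meet; rewrite (edge_colour_meet meet) // gi.
apply/eqP/setP=> A; rewrite [LHS]inE; apply/andP/idP => [[AE AM]|AM].
  move: (AE); rewrite inE => /existsP[x /existsP[y /andP[xy /eqP AxY]]].
  rewrite AxY subUset !sub1set in AM.
  case/andP: AM => /bigcupP[B /MP[e ei ->] xe] /bigcupP[D /MP[g gi ->] yg].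
  apply/MP; exists e => //; rewrite AxY.
  by rewrite (edge_colour_near xe yg xy) // ei.
by rewrite (subsetP sM) //; split=> //; apply: bigcup_sup AM.
Qed.

End Colouring.

Theorem theorem3p7 (Delta : nat) (G : sgraph) :
  4 <= Delta ->
  max_degree G <= Delta ->
  (forall s : seq G, is_cycle s -> ~~ odd (size s) -> 6 <= size s) ->
  (forall s : seq G, is_cycle s -> odd (size s) -> 2 * Delta - 1 <= size s) ->
  (mad G < 2 + 1 / (3 * Delta%:R - 2))%R ->
  strong_chromatic_index G <= 2 * Delta - 1.
Proof.
move=> n4 degG evenG oddG madG.
have n0 : 0 < Delta by apply: ltn_trans n4.
have [f fP] := exists_labelling (card_ord _) n4 evenG oddG degG
  (fun W => sparse_of_mad n0 madG) setT.
rewrite /strong_chromatic_index; case: ex_minnP => k _; apply.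
by apply/existsP; exists (finfun (edge_colour f n0)); apply: edge_colour_strong.
Qed.
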